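(* Let $(\Omega_{a,\epsilon})$, $a\in(0,1)$, $0<\epsilon<\epsilon_0(a)$, be a family of planar domains satisfying the standing assumptions (F) and (P1)--(P6) listed in the context, and let $u_{a,\epsilon}$ be the solution of $-\Delta u=1$ in $\Omega_{a,\epsilon}$, $u=0$ on $\partial\Omega_{a,\epsilon}$. Then there exists $b^*\in(0,1)$ such that for every $a\in(0,b^* )$ there is $\delta(a)\in(0,\epsilon_0(a)]$ such that, for every $\epsilon\in(0,\delta(a))$, the function $u_{a,\epsilon}$ has at least two distinct global maximizers in $\Omega_{a,\epsilon}$.
   Context: $B=B_1(0)\subset\mathbb R^2$ is the open unit disk. For $a\in(0,1)$ put $S_a=\bigl((-1,-a]\cup[a,1)\bigr)\times\{0\}$, $\overline{S_a}=\bigl([-1,-a]\cup[a,1]\bigr)\times\{0\}$ and $D_a=B\setminus S_a$. Standing assumptions on the family. For every $a\in(0,1)$ there is $\epsilon_0(a)>0$ such that, for all $0<\epsilon<\epsilon_0(a)$: (F) $\Omega_{a,\epsilon}=\{(x,y): |y|<1,\ -\rho_{a,\epsilon}(y)<x<\rho_{a,\epsilon}(y)\}$, where $\rho_{a,\epsilon}\in C^\infty((-1,1))\cap C([-1,1])$ is even, $0<\rho_{a,\epsilon}(y)\le\sqrt{1-y^2}$ for $|y|<1$, and $\rho_{a,\epsilon}(\pm1)=0$. The removed open slot is $T_{a,\epsilon}=\{(x,y)\in B: |x|>\rho_{a,\epsilon}(y)\}$, so that $\Omega_{a,\epsilon}=B\setminus\overline{T_{a,\epsilon}}$. (P1) $\Omega_{a,\epsilon}$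 is a bounded, $C^\infty$, simply connected, nonconvex planar domain, symmetric with respect to both coordinate axes. (P2) $\Omega_{a,\epsilon}\subset D_a$. (P3) $\overline{T_{a,\epsilon}}\to\overline{S_a}$ in Hausdorff distance as $\epsilon\to0$. (P4) $\Omega_{a,\epsilon_2}\subset\Omega_{a,\epsilon_1}$ whenever $0<\epsilon_1<\epsilon_2<\epsilon_0(a)$, and $\bigcup_{0<\epsilon<\epsilon_0(a)}\Omega_{a,\epsilon}=D_a$. (P5) $\Omega_{a,\epsilon}$ is star-shaped with respect to the origin: $t\Omega_{a,\epsilon}\subset\Omega_{a,\epsilon}$ for all $t\in[0,1]$. (P6) $\Omega_{a,\epsilon}$ is convex in the $x$-direction: for each $y\in(-1,1)$ the set $\{x:(x,y)\in\Omega_{a,\epsilon}\}$ is convex. *)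

(* Defs.v *)
From HB Require Import structures.
From mathcomp Require Import all_boot all_order all_algebra.
From mathcomp Require Import all_classical all_reals all_analysis.

Set Implicit Arguments.
Unset Strict Implicit.
Unset Printing Implicit Defensive.
Import Order.TTheory GRing.Theory Num.Theory.
Import numFieldNormedType.Exports.

Local Open Scope classical_set_scope.
Local Open Scope ring_scope.

(* The plane is R * R. Its library norm is the sup norm, which has the same
   topology and bounded sets as the Euclidean one; whatever depends on the
   metric itself is stated with the Euclidean distance [eucl_dist]. *)

Definition eucl_dist {R : realType} (p q : R * R) : R :=
  Num.sqrt ((p.1 - q.1) ^+ 2 + (p.2 - q.2) ^+ 2).

(* Closed r-neighbourhoods; the infimum is extended-real, so that the distance
   of the empty set to a nonempty set is +oo. *)
Definition hausdorff_dist {R : realType} (A B : set (R * R)) : \bar R :=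
  ereal_inf [set r%:E | r in [set r : R | [/\ 0 <= r,
    forall p, A p -> exists2 q, B q & eucl_dist p q <= r &
    forall q, B q -> exists2 p, A p & eucl_dist p q <= r]]].

Definition boundary {R : realType} (A : set (R * R)) : set (R * R) :=
  closure A `\` interior A.

Definition planar_domain {R : realType} (Om : set (R * R)) : Prop :=
  [/\ open Om, connected Om & Om !=set0].

(* Every loop is null-homotopic in Om relative to its base point; [H] is only
   constrained on the square [0, 1] x [0, 1]. *)
Definition simply_connected {R : realType} (Om : set (R * R)) : Prop :=
  connected Om /\
  forall gamma : R -> R * R,
    {within `[0, 1], continuous gamma} ->
    (forall t : R, t \in `[0, 1] -> Om (gamma t)) ->
    gamma 0 = gamma 1 ->
    exists H : R * R -> R * R,
      [/\ {within `[0, 1] `*` `[0, 1], continuous H},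
          forall s t : R, s \in `[0, 1] -> t \in `[0, 1] -> Om (H (s, t)),
          forall t : R, t \in `[0, 1] -> H (0, t) = gamma t,
          forall t : R, t \in `[0, 1] -> H (1, t) = gamma 0 &
          forall s : R, s \in `[0, 1] -> H (s, 0) = gamma 0 /\ H (s, 1) = gamma 0].

(* Meant for open [I] only: [derivable] is two-sided. *)
Definition smooth_on {R : realType} (I : set R) (f : R -> R) : Prop :=
  forall (n : nat) (t : R), I t -> derivable (derive1n n f) t 1.

(* Near each boundary point, Om is one side of the graph of a C^oo function
   after possibly exchanging the axes ([swap]); [above] tells which side. *)
Definition smooth_boundary {R : realType} (Om : set (R * R)) : Prop :=
  forall p, boundary Om p ->
  exists (r : R) (g : R -> R) (swap above : bool),
    [/\ 0 < r, smooth_on setT g &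
        forall q, eucl_dist p q < r ->
          let s := if swap then q.2 else q.1 in
          let t := if swap then q.1 else q.2 in
          Om q <-> (if above then g s < t else t < g s)].

(* Meant for open [U] only: continuity and derivability are taken in the whole
   plane. *)
Fixpoint Ck_on {R : realType} (k : nat) (U : set (R * R)) (f : R * R -> R)
    : Prop :=
  (forall p, U p -> {for p, continuous f}) /\
  match k with
  | 0 => True
  | k'.+1 => forall v : R * R, v = (1, 0) \/ v = (0, 1) ->
      (forall p, U p -> derivable f p v) /\ Ck_on k' U ('D_v f)
  end.

Definition laplacian {R : realType} (f : R * R -> R) (p : R * R) : R :=
  'D_((1, 0) : R * R) ('D_((1, 0) : R * R) f) p +
  'D_((0, 1) : R * R) ('D_((0, 1) : R * R) f) p.

(* Classical solution in C^2(Om) and C(closure Om); the values of [u] outside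
   the closure are irrelevant. *)
Definition torsion_solution {R : realType} (Om : set (R * R))
    (u : R * R -> R) : Prop :=
  [/\ Ck_on 2 Om u,
      {within closure Om, continuous u},
      forall p, Om p -> - laplacian u p = 1 &
      forall p, boundary Om p -> u p = 0].

Definition global_maximizer {R : realType} (Om : set (R * R))
    (u : R * R -> R) (p : R * R) : Prop :=
  Om p /\ forall q, Om q -> u q <= u p.

Definition unit_disk {R : realType} : set (R * R) :=
  [set p | p.1 ^+ 2 + p.2 ^+ 2 < 1].

Definition slit {R : realType} (a : R) : set (R * R) :=
  (`]-1, (- a)] `|` `[a, 1[) `*` [set 0].

Definition closed_slit {R : realType} (a : R) : set (R * R) :=
  (`[-1, (- a)] `|` `[a, 1]) `*` [set 0].

Definition slit_disk {R : realType} (a : R) : set (R * R) :=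
  unit_disk `\` slit a.

Definition profile_domain {R : realType} (rho : R -> R) : set (R * R) :=
  [set p | `|p.2| < 1 /\ - rho p.2 < p.1 < rho p.2].

Definition removed_slot {R : realType} (rho : R -> R) : set (R * R) :=
  [set p | unit_disk p /\ rho p.2 < `|p.1|].

Definition condF {R : realType} (rho : R -> R) (Om : set (R * R)) : Prop :=
  [/\ [/\ smooth_on `]-1, 1[ rho,
          {within `[-1, 1], continuous rho},
          forall y : R, y \in `[-1, 1] -> rho (- y) = rho y,
          forall y : R, `|y| < 1 -> 0 < rho y <= Num.sqrt (1 - y ^+ 2) &
          rho 1 = 0 /\ rho (- 1) = 0],
      Om = profile_domain rho &
      Om = unit_disk `\` closure (removed_slot rho)].

Definition condP1 {R : realType} (Om : set (R * R)) : Prop :=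
  [/\ planar_domain Om /\ bounded_set Om,
      smooth_boundary Om,
      simply_connected Om,
      ~ convex_set Om &
      forall x y, (Om (x, y) <-> Om (- x, y)) /\ (Om (x, y) <-> Om (x, - y))].

Definition condP2 {R : realType} (a : R) (Om : set (R * R)) : Prop :=
  Om `<=` slit_disk a.

Definition condP3 {R : realType} (a : R) (rho : R -> R -> R) : Prop :=
  hausdorff_dist (closure (removed_slot (rho e))) (closed_slit a)
    @[e --> 0^'+] --> 0%E.

Definition condP4 {R : realType} (a e0 : R) (Om : R -> set (R * R)) : Prop :=
  (forall e1 e2 : R, 0 < e1 -> e1 < e2 -> e2 < e0 -> Om e2 `<=` Om e1) /\
  \bigcup_(e in `]0, e0[) Om e = slit_disk a.

Definition condP5 {R : realType} (Om : set (R * R)) : Prop :=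
  forall (t : R) (p : R * R), 0 <= t <= 1 -> Om p -> Om (t *: p).

Definition condP6 {R : realType} (Om : set (R * R)) : Prop :=
  forall y : R, -1 < y < 1 -> convex_set [set x : R^o | Om (x, y)].

Definition standing_assumptions {R : realType} (eps0 : R -> R)
    (rho : R -> R -> R -> R) (Omega : R -> R -> set (R * R)) : Prop :=
  forall a : R, 0 < a < 1 ->
  [/\ 0 < eps0 a,
      forall e : R, 0 < e < eps0 a ->
        [/\ condF (rho a e) (Omega a e),
            condP1 (Omega a e),
            condP2 a (Omega a e),
            condP5 (Omega a e) &
            condP6 (Omega a e)],
      condP3 a (rho a) &
      condP4 a (eps0 a) (Omega a)].

(* Main.v *)
Require Import Defs.
From mathcomp Require Import all_boot all_order all_algebra.
From mathcomp Require Import all_classical all_reals all_analysis.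
From mathcomp Require Import ring lra.

Set Implicit Arguments.
Unset Strict Implicit.
Unset Printing Implicit Defensive.
Import Order.TTheory GRing.Theory Num.Theory.
Import numFieldNormedType.Exports.
Local Open Scope classical_set_scope.
Local Open Scope ring_scope.

(** The maximum of u is kept off the x-axis by two explicit barriers, and the
    symmetry of u then turns one maximizer into two.

    Upper barrier.  With z = x + i y, the real part of sqrt (a^2 - z^2) is
    harmonic off the two slits, vanishes on them, dominates |y|, and is at most
    a on the gap |x| < a, y = 0 between them; [slit_barrier a] is sqrt 2 times
    this function.  As |y| <= 1 in the disk, [slit_barrier a] - y^2 is
    nonnegative there; its Laplacian is -2 < -1, so it lies above u by the
    maximum principle ([torsion_le_barrier]).  Hence u <= 2 a on the x-axis,
    uniformly in epsilon.

    Lower barrier.  The points (1/2, 1/2) and (-1/2, 1/2) are off the slits, so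
    they belong to the domain for every small epsilon.  Convexity of the
    horizontal sections and star-shapedness then put the interior of the
    triangle spanned by them and the origin in the domain, and with it the disk
    of centre (0, 1/3) and radius 1/6 ([disk_sub_profile_domain]).  A paraboloid over that disk gives
    u (0, 1/3) >= 1/288 ([torsion_ge_paraboloid]).

    So if a < 1/576 every maximizer has y <> 0.  One exists by compactness, and
    its mirror image is another because u (x, -y) = u (x, y), which is
    uniqueness for the Dirichlet problem ([torsion_flip]).

    Only the strict form of the maximum principle is used: the barriers leave
    room for it, and uniqueness follows by adding eta x^2 and letting eta tend
    to 0. *)

(** * The strict maximum principle *)

Lemma second_derivative_le0_at_max (R : realType) (g g1 : R -> R) (t0 l e : R) :
  0 < e ->
  (forall t, `|t - t0| < e -> is_derive t 1 g (g1 t)) ->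
  is_derive t0 1 g1 l ->
  (forall t, `|t - t0| < e -> g t <= g t0) -> l <= 0.
Proof.
move=> e0 dg dg1 gmax; rewrite leNgt; apply/negP => l0.
have g10 : g1 t0 = 0.
  have t0in : t0 \in `]t0 - e, t0 + e[ by rewrite in_itv /=; lra.
  have near_t0 t : t \in `]t0 - e, t0 + e[ -> `|t - t0| < e.
    by rewrite in_itv /= ltr_norml; lra.
  have d0 : is_derive t0 1 g 0.
    apply: (derive1_at_max _ _ t0in); first by lra.
      by move=> t /near_t0 tt; exact: (@ex_derive _ _ _ _ _ _ _ (dg t tt)).
    by move=> t /near_t0; exact: gmax.
  have dt0 := dg t0 (near_t0 _ t0in).
  by rewrite -(@derive_val _ _ _ _ _ _ _ dt0) (@derive_val _ _ _ _ _ _ _ d0).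
case/is_derive1_caratheodory : dg1 => k [kE kc kt0].
have : \forall z \near t0, 0 < k z.
  by apply: (@cvgr_gt _ _ _ _ k (k t0) kc); rewrite kt0.
rewrite -nbhs_nearE => /nbhs_ballP[d /= d0 dk].
have [h h0 /andP[hd he]] : exists2 h, 0 < h & (h < d) && (h < e).
  exists (Num.min d e / 2); first by rewrite divr_gt0// lt_min d0 e0.
  by apply/andP; case: (leP d e); lra.
have close t : t \in `[t0, t0 + h] -> `|t - t0| < e.
  by rewrite in_itv /= ltr_norml; lra.
have [c cin] : exists2 c, c \in `]t0, t0 + h[ &
    g (t0 + h) - g t0 = g1 c * (t0 + h - t0).
  apply: MVT; first by lra.
    by move=> t tin; apply/dg/close; exact: subset_itv_oo_cc tin.
  apply: derivable_within_continuous => t /close tt.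
  exact: (@ex_derive _ _ _ _ _ _ _ (dg t tt)).
have : 0 < g1 c.
  have -> : g1 c = k c * (c - t0) by rewrite -kE g10 subr0.
  move: cin; rewrite in_itv /= => cin; apply: mulr_gt0; last by lra.
  by apply: dk; rewrite /ball /= ltr_norml; lra.
have := gmax (t0 + h) _; rewrite (_ : `|t0 + h - t0| < e = true); last first.
  by apply/close; rewrite in_itv /=; lra.
move=> /(_ isT) hle g1c gE.
have : 0 < g1 c * (t0 + h - t0) by rewrite mulr_gt0//; lra.
lra.
Qed.

(** The derivatives are carried as functions on the whole plane but only
    constrained along the coordinate lines through points of [Om]; this reduces
    computations to one variable and avoids differentiating a derivative that is
    known only locally. *)
Definition second_partials {R : realType} (Om : set (R * R))
    (f fx fxx fy fyy : R * R -> R) : Prop :=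
  forall x y, Om (x, y) ->
    [/\ is_derive x 1 (fun s => f (s, y)) (fx (x, y)),
        is_derive x 1 (fun s => fx (s, y)) (fxx (x, y)),
        is_derive y 1 (fun t => f (x, t)) (fy (x, y)) &
        is_derive y 1 (fun t => fy (x, t)) (fyy (x, y))].

Definition has_laplacian {R : realType} (Om : set (R * R))
    (f L : R * R -> R) : Prop :=
  exists fx fxx fy fyy : R * R -> R, second_partials Om f fx fxx fy fyy /\
    forall p, Om p -> L p = fxx p + fyy p.

Lemma bounded_closure_compact (R : realType) (A : set (R * R)) :
  bounded_set A -> compact (closure A).
Proof.
case=> M [_ /(_ (M + 1))]; rewrite ltrDl ltr01 => /(_ isT) Mb.
pose I := `[- (M + 1), M + 1]%classic : set R.
have cI : compact (I `*` I) by apply: compact_setX; exact: segment_compact.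
apply: (subclosed_compact (@closed_closure _ _) cI).
have cl : closed (I `*` I).
  apply: compact_closed => //; exact: (@norm_hausdorff _ (R * R)%type).
rewrite [X in _ `<=` X]((closure_id _).1 cl).
apply: closureS => -[x y] /Mb /=; rewrite prod_normE /= ge_max => /andP[].
by rewrite !ler_norml /I /= !in_itv.
Qed.

Lemma open_ball_itv (R : realType) (Om : set (R * R)) (x y : R) :
  open Om -> Om (x, y) ->
  exists2 e, 0 < e & forall s t, `|s - x| < e -> `|t - y| < e -> Om (s, t).
Proof.
move=> oOm Omp.
have /nbhs_ballP[e /= e0 eOm] : nbhs (x, y) Om by exact: open_nbhs_nbhs.
exists e => // s t sx ty; apply: eOm; split; rewrite /ball /= distrC //.
Qed.

(** At an interior maximum both pure second derivatives are nonpositive, which a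
    positive Laplacian forbids; so the maximum over the compact closure sits on
    the boundary. *)
Lemma strict_maximum_principle (R : realType) (Om : set (R * R))
    (f L : R * R -> R) (M : R) :
  open Om -> bounded_set Om ->
  {within closure Om, continuous f} ->
  has_laplacian Om f L -> (forall p, Om p -> 0 < L p) ->
  (forall p, boundary Om p -> f p <= M) ->
  forall p, Om p -> f p <= M.
Proof.
move=> oOm bOm cf [fx [fxx [fy [fyy [fP fL]]]]] Lpos fM p Omp.
have clp : closure Om !=set0 by exists p; exact: subset_closure.
have [[x y]] := compact_EVT_max clp (bounded_closure_compact bOm) cf.
rewrite inE => clc cmax.
have fpc : f p <= f (x, y) by apply: cmax; rewrite inE; exact: subset_closure.
apply: (le_trans fpc).
have [Omc|nOmc] := pselect (Om (x, y)); last first.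
  by apply: fM; split => //; rewrite (interior_id _).1.
have [e e0 eOm] := open_ball_itv oOm Omc.
have {}cmax q : Om q -> f q <= f (x, y).
  by move=> Omq; apply: cmax; rewrite inE; exact: subset_closure.
have z0 (z : R) : `|z - z| < e by rewrite subrr normr0.
have [_ dxx _ dyy] := fP _ _ Omc.
have xx0 : fxx (x, y) <= 0.
  apply: (second_derivative_le0_at_max e0 _ dxx) => t tx.
    by have [d _ _ _] := fP _ _ (eOm _ _ tx (z0 y)); exact: d.
  exact: (cmax _ (eOm _ _ tx (z0 y))).
have yy0 : fyy (x, y) <= 0.
  apply: (second_derivative_le0_at_max e0 _ dyy) => t ty.
    by have [_ _ d _] := fP _ _ (eOm _ _ (z0 x) ty); exact: d.
  exact: (cmax _ (eOm _ _ (z0 x) ty)).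
have := Lpos _ Omc; rewrite fL//; lra.
Qed.

(** * Calculus of second partial derivatives *)

Section OneVariable.
Variable R : realType.
Implicit Types (f g : R -> R) (x a b c : R).

Lemma is_derive_sqrt_comp f x a : 0 < f x -> is_derive x 1 f a ->
  is_derive x 1 (fun s => Num.sqrt (f s)) (a / (2 * Num.sqrt (f x))).
Proof.
move=> fx0 df; rewrite mulrC; exact: (is_derive1_comp (is_derive1_sqrt fx0) df).
Qed.

Lemma is_derive_div f g x a b :
  is_derive x 1 f a -> is_derive x 1 g b -> g x != 0 ->
  is_derive x 1 (fun s => f s / g s) (a / g x - f x * b / g x ^+ 2).
Proof.
move=> df dg gx0.
apply: (is_derive_eq (is_deriveM df (is_deriveV gx0 dg))).
by rewrite /GRing.scale /=; field.
Qed.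

Lemma is_derive_quadratic x a c d :
  is_derive x 1 (fun s => a * (s - c) ^+ 2 + d) (2 * a * (x - c)).
Proof.
have dl : is_derive x 1 (fun s : R => s - c) 1.
  apply: (is_derive_eq (is_deriveB (is_derive_id x 1) (is_derive_cst c x 1))).
  by rewrite subr0.
apply: (is_derive_eq (is_deriveD (is_deriveZ a (is_deriveX 2 dl))
  (is_derive_cst d x 1))).
by rewrite /GRing.scale /= expr1; ring.
Qed.

Lemma is_derive_linear x a c :
  is_derive x 1 (fun s => a * (s - c)) a.
Proof.
have dl := is_deriveB (is_derive_id x 1) (is_derive_cst c x 1).
apply: (is_derive_eq (is_deriveZ a dl)).
by rewrite /GRing.scale /= subr0 mulr1.
Qed.

Lemma is_derive_opp f x a :
  is_derive (- x) 1 f a -> is_derive x 1 (fun s => f (- s)) (- a).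
Proof.
move=> df; rewrite -mulrN1.
exact: (is_derive1_comp df (is_deriveNid x 1)).
Qed.

End OneVariable.

Section Laplacian.
Variable R : realType.
Implicit Types (Om : set (R * R)) (f g L : R * R -> R).

Lemma second_partialsD Om f fx fxx fy fyy g gx gxx gy gyy :
  second_partials Om f fx fxx fy fyy -> second_partials Om g gx gxx gy gyy ->
  second_partials Om (fun p => f p + g p) (fun p => fx p + gx p)
    (fun p => fxx p + gxx p) (fun p => fy p + gy p) (fun p => fyy p + gyy p).
Proof.
move=> fP gP x y Omxy.
have [f1 f2 f3 f4] := fP _ _ Omxy; have [g1 g2 g3 g4] := gP _ _ Omxy.
by split; [exact: (is_deriveD f1 g1)|exact: (is_deriveD f2 g2)|
  exact: (is_deriveD f3 g3)|exact: (is_deriveD f4 g4)].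
Qed.

Lemma second_partialsN Om f fx fxx fy fyy :
  second_partials Om f fx fxx fy fyy ->
  second_partials Om (fun p => - f p) (fun p => - fx p) (fun p => - fxx p)
    (fun p => - fy p) (fun p => - fyy p).
Proof.
move=> fP x y Omxy; have [f1 f2 f3 f4] := fP _ _ Omxy.
by split; [exact: (is_deriveN f1)|exact: (is_deriveN f2)|
  exact: (is_deriveN f3)|exact: (is_deriveN f4)].
Qed.

Lemma second_partials_sqr Om f fx fxx fy fyy :
  second_partials Om f fx fxx fy fyy ->
  second_partials Om (fun p => f p ^+ 2)
    (fun p => 2 * (f p * fx p)) (fun p => 2 * (fx p ^+ 2 + f p * fxx p))
    (fun p => 2 * (f p * fy p)) (fun p => 2 * (fy p ^+ 2 + f p * fyy p)).
Proof.
move=> fP x y Omxy; have [f1 f2 f3 f4] := fP _ _ Omxy; split.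
- by apply: (is_derive_eq (is_deriveX 2 f1)); rewrite /GRing.scale /=; ring.
- apply: (is_derive_eq (is_deriveZ 2 (is_deriveM f1 f2))).
  by rewrite /GRing.scale /=; ring.
- by apply: (is_derive_eq (is_deriveX 2 f3)); rewrite /GRing.scale /=; ring.
- apply: (is_derive_eq (is_deriveZ 2 (is_deriveM f3 f4))).
  by rewrite /GRing.scale /=; ring.
Qed.

Lemma second_partials_sqrt Om f fx fxx fy fyy :
  (forall p, Om p -> 0 < f p) ->
  second_partials Om f fx fxx fy fyy ->
  second_partials Om (fun p => Num.sqrt (f p))
    (fun p => fx p / (2 * Num.sqrt (f p)))
    (fun p => (fxx p - fx p ^+ 2 / (2 * f p)) / (2 * Num.sqrt (f p)))
    (fun p => fy p / (2 * Num.sqrt (f p)))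
    (fun p => (fyy p - fy p ^+ 2 / (2 * f p)) / (2 * Num.sqrt (f p))).
Proof.
move=> f0 fP x y Omxy; have [f1 f2 f3 f4] := fP _ _ Omxy.
have fxy0 := f0 _ Omxy.
have s0 : 0 < Num.sqrt (f (x, y)) by rewrite sqrtr_gt0.
have fE : f (x, y) = Num.sqrt (f (x, y)) ^+ 2 by rewrite sqr_sqrtr// ltW.
have s20 : 2 * Num.sqrt (f (x, y)) != 0 by lra.
split.
- exact: (is_derive_sqrt_comp fxy0 f1).
- have d : is_derive x 1 (fun s => 2 * Num.sqrt (f (s, y))) _ :=
    is_deriveZ 2 (is_derive_sqrt_comp fxy0 f1).
  apply: (is_derive_eq (is_derive_div f2 d s20)).
  rewrite {4}fE /GRing.scale /=; field; lra.
- exact: (is_derive_sqrt_comp fxy0 f3).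
- have d : is_derive y 1 (fun s => 2 * Num.sqrt (f (x, s))) _ :=
    is_deriveZ 2 (is_derive_sqrt_comp fxy0 f3).
  apply: (is_derive_eq (is_derive_div f4 d s20)).
  rewrite {4}fE /GRing.scale /=; field; lra.
Qed.

Lemma second_partials_quadratic Om (a b c d : R) :
  second_partials Om (fun p => a * p.1 ^+ 2 + b * (p.2 - c) ^+ 2 + d)
    (fun p => 2 * a * (p.1 - 0)) (fun=> 2 * a)
    (fun p => 2 * b * (p.2 - c)) (fun=> 2 * b).
Proof.
move=> x y _ /=; split=> //.
- rewrite (_ : (fun _ => _) =
      fun s => a * (s - 0) ^+ 2 + (b * (y - c) ^+ 2 + d)).
    exact: is_derive_quadratic.
  by apply/funext => s; rewrite subr0 addrA.
- exact: is_derive_linear.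
- rewrite (_ : (fun _ => _) = fun s => b * (s - c) ^+ 2 + (a * x ^+ 2 + d)).
    exact: is_derive_quadratic.
  by apply/funext => s; ring.
- exact: is_derive_linear.
Qed.

Lemma has_laplacianB Om f g L L' :
  has_laplacian Om f L -> has_laplacian Om g L' ->
  has_laplacian Om (fun p => f p - g p) (fun p => L p - L' p).
Proof.
move=> [fx [fxx [fy [fyy [fP fL]]]]] [gx [gxx [gy [gyy [gP gL]]]]].
do 4 eexists; split; first exact: (second_partialsD fP (second_partialsN gP)).
by move=> p Omp /=; rewrite fL// gL//; ring.
Qed.

Lemma has_laplacian_quadratic Om (a b c d : R) :
  has_laplacian Om (fun p => a * p.1 ^+ 2 + b * (p.2 - c) ^+ 2 + d)
    (fun=> 2 * a + 2 * b).
Proof. by do 4 eexists; split; first exact: second_partials_quadratic. Qed.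

Definition flip (p : R * R) : R * R := (p.1, - p.2).

Lemma has_laplacian_flip Om f L :
  has_laplacian Om f L ->
  has_laplacian (flip @^-1` Om) (f \o flip) (L \o flip).
Proof.
move=> [fx [fxx [fy [fyy [fP fL]]]]].
exists (fx \o flip), (fxx \o flip), (fun p => - fy (flip p)), (fyy \o flip).
split=> [x y Omxy|p]; last exact: fL.
have [f1 f2 f3 f4] := fP _ _ Omxy.
split => //=; first exact: is_derive_opp f3.
by rewrite -[fyy _]opprK; exact: (is_deriveN (is_derive_opp f4)).
Qed.

Lemma is_derive_section1 f x y : derivable f (x, y) (1, 0) ->
  is_derive x 1 (fun s => f (s, y)) ('D_((1, 0) : R * R) f (x, y)).
Proof.
move=> df; set g := fun s => f (s, y).
have E : (fun h : R => h^-1 *: ((g \o shift x) (h *: 1) - g x)) =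
    (fun h : R => h^-1 *: ((f \o shift (x, y)) (h *: (1, 0)) - f (x, y))).
  apply/funext => h /=; congr (_ *: (f _ - _)).
  by congr (_, _); rewrite /= scaler0 add0r.
have dg : derivable g x 1 by rewrite /derivable E.
by apply: (DeriveDef dg); rewrite /derive E.
Qed.

Lemma is_derive_section2 f x y : derivable f (x, y) (0, 1) ->
  is_derive y 1 (fun t => f (x, t)) ('D_((0, 1) : R * R) f (x, y)).
Proof.
move=> df; set g := fun t => f (x, t).
have E : (fun h : R => h^-1 *: ((g \o shift y) (h *: 1) - g y)) =
    (fun h : R => h^-1 *: ((f \o shift (x, y)) (h *: (0, 1)) - f (x, y))).
  apply/funext => h /=; congr (_ *: (f _ - _)).
  by congr (_, _); rewrite /= scaler0 add0r.
have dg : derivable g y 1 by rewrite /derivable E.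
by apply: (DeriveDef dg); rewrite /derive E.
Qed.

Lemma torsion_has_laplacian Om u :
  torsion_solution Om u -> has_laplacian Om u (fun=> -1).
Proof.
case=> -[_ C2] _ lu _.
have [d1 [_ C1]] := C2 (1, 0) (or_introl erefl).
have [d2 [_ C1']] := C2 (0, 1) (or_intror erefl).
have [d11 _] := C1 (1, 0) (or_introl erefl).
have [d22 _] := C1' (0, 1) (or_intror erefl).
exists ('D_((1, 0) : R * R) u), ('D_((1, 0) : R * R) ('D_((1, 0) : R * R) u)),
  ('D_((0, 1) : R * R) u), ('D_((0, 1) : R * R) ('D_((0, 1) : R * R) u)).
split=> [x y Omxy|p Omp]; last exact: (esym (canRL opprK (lu _ Omp))).
split.
- exact/is_derive_section1/d1.
- exact/is_derive_section1/d11.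
- exact/is_derive_section2/d2.
- exact/is_derive_section2/d22.
Qed.

End Laplacian.

(** * The harmonic barrier of the slit disk *)

Section Barrier.
Variables (R : realType) (a : R).
Hypothesis a0 : 0 < a.
Implicit Types p : R * R.

(* Real part and, up to sign, imaginary part of a^2 - z^2. *)
Let re p := a ^+ 2 - p.1 ^+ 2 + p.2 ^+ 2.
Let im p := 2 * p.1 * p.2.

Definition slit_modulus p : R := Num.sqrt (re p ^+ 2 + im p ^+ 2).
(** This is sqrt 2 times the real part of the principal square root of
    a^2 - z^2, since 2 (Re sqrt w)^2 = |w| + Re w. *)
Definition slit_barrier p : R := Num.sqrt (slit_modulus p + re p).

Let re_partials Om : second_partials Om re (fun p => - 2 * p.1) (fun=> - 2)
  (fun p => 2 * p.2) (fun=> 2).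
Proof.
have h := @second_partials_quadratic R Om (-1) 1 0 (a ^+ 2).
have E : re = fun p => -1 * p.1 ^+ 2 + 1 * (p.2 - 0) ^+ 2 + a ^+ 2.
  by apply/funext => p; rewrite /re; ring.
have Ex : (fun p => - 2 * p.1) = fun p : R * R => 2 * -1 * (p.1 - 0).
  by apply/funext => p; ring.
have Ey : (fun p => 2 * p.2) = fun p : R * R => 2 * 1 * (p.2 - 0).
  by apply/funext => p; ring.
by move: h; rewrite -E -Ex -Ey mulrN1 mulr1.
Qed.

Let im_partials Om : second_partials Om im (fun p => 2 * p.2) (fun=> 0)
  (fun p => 2 * p.1) (fun=> 0).
Proof.
move=> x y _; split => /=; try exact: is_derive_cst.
- rewrite (_ : (fun _ => _) = fun s => 2 * y * (s - 0)).
    exact: is_derive_linear.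
  by apply/funext => s; rewrite /im /=; ring.
- rewrite (_ : (fun _ => _) = fun s => 2 * x * (s - 0)).
    exact: is_derive_linear.
  by apply/funext => s; rewrite /im /=; ring.
Qed.

Lemma sqr_slit_modulus p : slit_modulus p ^+ 2 = re p ^+ 2 + im p ^+ 2.
Proof. by rewrite sqr_sqrtr// addr_ge0// sqr_ge0. Qed.

Lemma ger_slit_modulus p (c : R) :
  c ^+ 2 <= re p ^+ 2 + im p ^+ 2 -> c <= slit_modulus p.
Proof.
by move=> cp; rewrite (le_trans (ler_norm c))// -sqrtr_sqr ler_wsqrtr.
Qed.

(** |w| + Re w vanishes exactly when w is a nonpositive real, and a^2 - z^2 is
    such precisely when z is real with |z| >= a. *)
Lemma slit_modulus_addre_gt0 p : slit_disk a p -> 0 < slit_modulus p + re p.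
Proof.
case: p => x y [/= disk nslit]; rewrite ltNge; apply/negP => le0.
have B0 : 0 <= slit_modulus (x, y) by exact: sqrtr_ge0.
have := sqr_slit_modulus (x, y).
have ax := sqr_ge0 x; have ay := sqr_ge0 y.
have a2 : 0 < a ^+ 2 by rewrite exprn_gt0.
have im0 : 0 <= im (x, y) ^+ 2 by rewrite sqr_ge0.
move=> BE; have {BE} : im (x, y) ^+ 2 = 0 by nra.
move/eqP; rewrite sqrf_eq0 /im /= !mulf_eq0 pnatr_eq0 /= => /orP[]/eqP z0.
  by move: le0 B0; rewrite /re /= z0 expr0n /=; lra.
apply: nslit; split => //=; move: le0 B0; rewrite /re /= z0 => le0 B0.
move: disk; rewrite /unit_disk /= z0 expr0n /= addr0 => x1.
have a2x2 : a ^+ 2 <= x ^+ 2 by move: le0; rewrite expr0n /=; lra.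
have {}a2x2 : a <= `|x|.
  by rewrite -(@ler_pXn2r _ 2) ?nnegrE// ?(ltW a0)// real_normK ?num_real.
have {}x1 : `|x| < 1.
  by rewrite -(@ltr_pXn2r _ 2) ?nnegrE// real_normK ?num_real// expr1n.
rewrite /slit /= !in_itv /=; move: a2x2 x1.
case: (ger0P x) => _; [right|left]; lra.
Qed.

(** The real part of a holomorphic function is harmonic.  The computation uses
    holomorphy only through a^2 - z^2: its real part A and imaginary part C are
    harmonic, with orthogonal gradients of equal length 2 |z|. *)
Lemma slit_barrier_harmonic :
  has_laplacian (slit_disk a) slit_barrier (fun=> 0).
Proof.
have Gpos := slit_modulus_addre_gt0.
have Bpos p : slit_disk a p -> 0 < slit_modulus p.
  move=> /Gpos; have := @ger_slit_modulus p (re p); rewrite lerDl sqr_ge0.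
  by move=> /(_ isT); lra.
have Npos p : slit_disk a p -> 0 < re p ^+ 2 + im p ^+ 2.
  by move=> /Bpos; rewrite sqrtr_gt0.
have NP := second_partialsD (second_partials_sqr (@re_partials (slit_disk a)))
  (second_partials_sqr (@im_partials (slit_disk a))).
have BP := second_partials_sqrt Npos NP.
have GP := second_partialsD BP (@re_partials (slit_disk a)).
have hP := second_partials_sqrt Gpos GP.
do 4 eexists; split; first exact: hP.
move=> p Omp /=.
have := sqr_slit_modulus p; have := Gpos p Omp; have := Bpos p Omp.
rewrite -/(slit_modulus p).
have : 0 < Num.sqrt (slit_modulus p + re p) by rewrite sqrtr_gt0 Gpos.
set h := Num.sqrt _; set B := slit_modulus p; set A := re p; set C := im p.
move: p.1 p.2 => x y h0 B0 G0 BE; rewrite -BE.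
(* [Nx] and [Ny] are the partial derivatives of B^2 = A^2 + C^2. *)
set Nx := 2 * (A * (-2 * x)) + _; set Ny := 2 * (A * (2 * y)) + _.
have S : Nx ^+ 2 + Ny ^+ 2 = 16 * (x ^+ 2 + y ^+ 2) * B ^+ 2.
  by rewrite BE /Nx /Ny; ring.
have T : Ny * (2 * y) - Nx * (2 * x) = 8 * A * (x ^+ 2 + y ^+ 2).
  by rewrite /Nx /Ny; ring.
transitivity (((16 * (x ^+ 2 + y ^+ 2)
    - (Nx ^+ 2 + Ny ^+ 2) / (2 * B ^+ 2)) / (2 * B)
  - ((Nx ^+ 2 + Ny ^+ 2) / (4 * B ^+ 2)
    + (Ny * (2 * y) - Nx * (2 * x)) / B + 4 * (x ^+ 2 + y ^+ 2))
    / (2 * (B + A))) / (2 * h)).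
  by rewrite S T; field; lra.
by field; lra.
Qed.

Lemma ler_slit_barrier p : `|p.2| <= slit_barrier p.
Proof.
rewrite -sqrtr_sqr ler_wsqrtr//.
have : p.2 ^+ 2 + p.1 ^+ 2 - a ^+ 2 <= slit_modulus p.
  apply: ger_slit_modulus; rewrite /re /im -subr_ge0.
  (* |a^2 - z^2|^2 - (x^2 + y^2 - a^2)^2 = 4 a^2 y^2 *)
  rewrite (_ : _ - _ = (2 * a * p.2) ^+ 2); last by ring.
  exact: sqr_ge0.
rewrite /re; have := sqr_ge0 p.2.
by move: (slit_modulus p) p.1 p.2 => B x y; lra.
Qed.

Lemma slit_barrier_gap (x : R) : `|x| <= a -> slit_barrier (x, 0) <= 2 * a.
Proof.
move=> xa; have a20 : 0 <= 2 * a by rewrite mulr_ge0// ltW.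
have rx : 0 <= re (x, 0).
  rewrite /re /= expr0n /= addr0 subr_ge0 -(real_normK (num_real x)).
  by rewrite ler_pXn2r ?nnegrE// ltW.
rewrite -[2 * a](ger0_norm a20) -sqrtr_sqr ler_wsqrtr//.
rewrite /slit_modulus {1}/im /= mulr0 expr0n /= addr0 sqrtr_sqr ger0_norm//.
rewrite /re /= expr0n /=; have := sqr_ge0 x; have := sqr_ge0 a; lra.
Qed.

Lemma continuous_slit_barrier : continuous slit_barrier.
Proof.
have sqr (f : R * R -> R) : continuous f -> continuous (fun p => f p ^+ 2).
  by move=> cf p; exact: (cvgM (cf p) (cf p)).
have cre : continuous re.
  move=> p; apply: cvgD; last by apply: (sqr snd) => q; exact: cvg_snd.
  apply: cvgB; first exact: cvg_cst.
  by apply: (sqr fst) => q; exact: cvg_fst.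
have cim : continuous im.
  move=> p; apply: cvgM; last exact: cvg_snd.
  by apply: cvgM; [exact: cvg_cst|exact: cvg_fst].
have root (f : R * R -> R) :
    continuous f -> continuous (fun p => Num.sqrt (f p)).
  by move=> cf p; exact: (continuous_comp (cf p) (@sqrt_continuous R (f p))).
have cmod : continuous slit_modulus.
  by apply: root => p; apply: cvgD; [exact: sqr cre p|exact: sqr cim p].
by apply: root => p; apply: cvgD; [exact: cmod|exact: cre].
Qed.

End Barrier.

(** * Comparison with the torsion function *)

Section Comparison.
Variable R : realType.
Implicit Types (Om : set (R * R)) (u : R * R -> R) (a : R).

Lemma has_laplacianS Om Om' (f L : R * R -> R) :
  Om' `<=` Om -> has_laplacian Om f L -> has_laplacian Om' f L.
Proof.
move=> sub [fx [fxx [fy [fyy [fP fL]]]]]; exists fx, fxx, fy, fyy.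
by split=> [x y /sub|p /sub]; [exact: fP|exact: fL].
Qed.

Lemma continuous_quadratic (a b c d : R) :
  continuous (fun p : R * R => a * p.1 ^+ 2 + b * (p.2 - c) ^+ 2 + d).
Proof.
move=> p; apply: cvgD; last exact: cvg_cst.
have c2 : (q.2 - c) @[q --> p] --> p.2 - c.
  by apply: cvgB; [exact: cvg_snd|exact: cvg_cst].
apply: cvgD; apply: cvgM; first exact: cvg_cst.
- exact: (cvgM (@cvg_fst _ _ _ _ _) (@cvg_fst _ _ _ _ _)).
- exact: cvg_cst.
- exact: (cvgM c2 c2).
Qed.

Lemma closure_unit_disk Om p : Om `<=` unit_disk -> closure Om p ->
  p.1 ^+ 2 + p.2 ^+ 2 <= 1.
Proof.
move=> sub /(closureS sub).
have -> : unit_disk =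
    [set q : R * R | 1 * q.1 ^+ 2 + 1 * (q.2 - 0) ^+ 2 + 0 < 1].
  by apply/seteqP; split => q; rewrite /unit_disk /= subr0 addr0 !mul1r.
set q2 := fun q : R * R => 1 * q.1 ^+ 2 + 1 * (q.2 - 0) ^+ 2 + 0.
have cl : closed (q2 @^-1` [set x | x <= 1]).
  apply: closed_comp; last exact: closed_le.
  by move=> q _; exact: continuous_quadratic.
move=> clp; suff : q2 p <= 1 by rewrite /q2 subr0 addr0 !mul1r.
apply: (cl p); apply: closureS clp => q; exact: ltW.
Qed.

Lemma unit_disk_bounded Om : Om `<=` unit_disk -> bounded_set Om.
Proof.
move=> sub; exists 1; split => // M M1 p /sub; rewrite /unit_disk /= => p1.
rewrite prod_normE (le_trans _ (ltW M1))// ge_max.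
have := sqr_ge0 p.1; have := sqr_ge0 p.2 => p20 p10.
by rewrite -![`|_| <= 1](@ler_pXn2r _ 2) ?nnegrE// !real_normK ?num_real//
  expr1n; apply/andP; split; lra.
Qed.

(** u - u o flip is harmonic and vanishes on the boundary.  Adding eta x^2 makes
    the Laplacian positive at the cost of a boundary value of at most eta. *)
Lemma torsion_flip Om u :
  open Om -> Om `<=` unit_disk -> (forall p, Om p <-> Om (flip p)) ->
  torsion_solution Om u -> forall p, Om p -> u (flip p) = u p.
Proof.
move=> oOm sub sym tu.
have flipK (p : R * R) : flip (flip p) = p.
  by case: p => x y; rewrite /flip /= opprK.
have cflip : continuous (@flip R).
  move=> p.
  have c1 : q.1 @[q --> p] --> p.1 by exact: cvg_fst.
  have c2 : (- q.2) @[q --> p] --> - p.2 by apply: cvgN; exact: cvg_snd.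
  exact: (cvg_pair c1 c2).
have OmE : @flip R @^-1` Om = Om by apply/seteqP; split => p;
    [exact: (sym p).2|exact: (sym p).1].
have clflip p : closure Om p -> closure Om (flip p).
  move=> clp B /cflip Bp; have [q [Omq Bq]] := clp _ Bp.
  by exists (flip q); split => //; exact/(sym q).1.
have [_ cu _ bu] := tu.
have lu := torsion_has_laplacian tu.
have lf : has_laplacian Om (u \o @flip R) (fun=> -1).
  by rewrite -OmE; exact: has_laplacian_flip lu.
have cf : {within closure Om, continuous (u \o @flip R)}.
  apply/subspace_continuousP => p clp.
  have := (subspace_continuousP _ _).1 cu _ (clflip p clp).
  apply: cvg_trans => B /= Bp.
  have := cflip p _ Bp; rewrite /nbhs /=.
  rewrite /within /=; apply: filterS => q Bq clq; apply: Bq; exact: clflip.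
suff le p : Om p -> u p <= u (flip p).
  move=> p Omp; apply/eqP; rewrite eq_le le// andbT.
  by rewrite -{2}[p]flipK le//; exact/(sym p).1.
move=> Omp; apply/ler_addgt0Pr => eta eta0.
have lq := @has_laplacian_quadratic R Om (- eta) 0 0 0.
have := strict_maximum_principle oOm (unit_disk_bounded sub) _
  (has_laplacianB (has_laplacianB lu lf) lq) _ (M := eta).
move=> /(_ _ _ _ p Omp)/=; set P := (X in X -> _) => H.
have cq := @continuous_quadratic (- eta) 0 0 0.
have : u p - u (flip p) - (- eta * p.1 ^+ 2 + 0 * (p.2 - 0) ^+ 2 + 0) <= eta.
  apply: H.
  - apply: (within_continuousB (within_continuousB cu cf)).
    exact: continuous_subspaceT cq.
  - by move=> q _; lra.
  - move=> q [clq nq].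
    have -> : u q = 0 by apply: bu.
    have -> : u (flip q) = 0.
      apply: bu; split; first exact: clflip.
      by move: nq; rewrite (interior_id _).1// => nq /(sym q).2.
    have := closure_unit_disk sub clq; have := sqr_ge0 q.2; nra.
have := sqr_ge0 p.1; nra.
Qed.

(** On the boundary the right-hand side is at least |y| - y^2 >= 0. *)
Lemma torsion_le_barrier a Om u : 0 < a ->
  open Om -> Om `<=` slit_disk a -> torsion_solution Om u ->
  forall p, Om p -> u p <= slit_barrier a p - p.2 ^+ 2.
Proof.
move=> a0 oOm sub tu p Omp; have [_ cu _ bu] := tu.
have sub1 : Om `<=` unit_disk by move=> q /sub[].
have lh := has_laplacianS sub (slit_barrier_harmonic a0).
have lq := @has_laplacian_quadratic R Om 0 (-1) 0 0.
have : u p - slit_barrier a p - (0 * p.1 ^+ 2 + -1 * (p.2 - 0) ^+ 2 + 0) <= 0.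
  apply: (strict_maximum_principle oOm (unit_disk_bounded sub1) _
    (has_laplacianB (has_laplacianB (torsion_has_laplacian tu) lh) lq) _ _ Omp).
  - apply: within_continuousB; last first.
      exact/continuous_subspaceT/continuous_quadratic.
    apply: (within_continuousB cu).
    exact/continuous_subspaceT/continuous_slit_barrier.
  - by move=> q _ /=; lra.
  - move=> q bq; rewrite bu//; have := closure_unit_disk sub1 bq.1.
    have := ler_slit_barrier a q; have := sqr_ge0 q.1.
    rewrite -(real_normK (num_real q.2)) mul0r add0r subr0 addr0 mulN1r.
    have : q.2 ^+ 2 = `|q.2| ^+ 2 by rewrite real_normK ?num_real.
    move: `|q.2| (normr_ge0 q.2) => t t0 ->; nra.
rewrite subr0; lra.
Qed.

(** The paraboloid (r^2 - |p - (0, c)|^2) / 8 has Laplacian -1/2 > -1, hence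
    lies below u as soon as it is nonpositive on the boundary.  The exact
    torsion function of the disk, with 1/4 for 1/8, would leave no strict
    inequality. *)
Lemma torsion_ge_paraboloid Om u (c r : R) :
  open Om -> bounded_set Om -> torsion_solution Om u ->
  (forall p, p.1 ^+ 2 + (p.2 - c) ^+ 2 < r ^+ 2 -> Om p) ->
  Om (0, c) -> r ^+ 2 / 8 <= u (0, c).
Proof.
move=> oOm bOm tu disk Omc; have [_ cu _ bu] := tu.
have lq := @has_laplacian_quadratic R Om (- 8^-1) (- 8^-1) c (r ^+ 2 / 8).
have : - 8^-1 * 0 ^+ 2 + - 8^-1 * (c - c) ^+ 2 + r ^+ 2 / 8 - u (0, c) <= 0.
  apply: (strict_maximum_principle oOm bOm _
    (has_laplacianB lq (torsion_has_laplacian tu)) _ _ Omc).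
  - apply: within_continuousB cu.
    exact/continuous_subspaceT/continuous_quadratic.
  - by move=> q _ /=; lra.
  - move=> q bq; rewrite bu// subr0.
    have : r ^+ 2 <= q.1 ^+ 2 + (q.2 - c) ^+ 2.
      rewrite leNgt; apply/negP => /disk.
      by case: bq => _; rewrite (interior_id _).1.
    by lra.
by rewrite subrr expr0n /=; lra.
Qed.

(** A point (x, y) with |x| < y < 1/2 is 2 y times the point (x / (2 y), 1/2) of
    the horizontal segment joining (-1/2, 1/2) to (1/2, 1/2). *)
Lemma disk_sub_profile_domain (rho : R -> R) Om p :
  Om = profile_domain rho -> condP5 Om -> Om (2^-1, 2^-1) ->
  p.1 ^+ 2 + (p.2 - 3^-1) ^+ 2 < 6^-1 ^+ 2 -> Om p.
Proof.
move=> OmE star; rewrite {1}OmE => -[/= _ /andP[_ hrho]]; case: p => x y /= xy.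
have near0 (t : R) : t ^+ 2 < 6^-1 ^+ 2 -> - 6^-1 < t < 6^-1.
  move=> t6; rewrite -ltr_norml -(@ltr_pXn2r _ 2) ?nnegrE//.
  by rewrite real_normK ?num_real.
have /andP[x6 x6'] : - 6^-1 < x < 6^-1.
  by apply: near0; have := sqr_ge0 (y - 3^-1); lra.
have /andP[y6 y2] : - 6^-1 < y - 3^-1 < 6^-1.
  by apply: near0; have := sqr_ge0 x; lra.
have -> : (x, y) = (2 * y) *: ((x / (2 * y), 2^-1) : R * R).
  by congr (_, _); rewrite /GRing.scale /=; clear OmE; field; lra.
apply: star; first by apply/andP; split; lra.
rewrite OmE; split => /=; first by rewrite ger0_norm; lra.
have y0 : 0 < 2 * y by lra.
have : - 2^-1 < x / (2 * y) by rewrite ltr_pdivlMr//; nra.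
have : x / (2 * y) < 2^-1 by rewrite ltr_pdivrMr//; nra.
lra.
Qed.

End Comparison.

(** * Two maximizers *)

Theorem theorem1p3 (R : realType) (eps0 : R -> R) (rho : R -> R -> R -> R)
    (Omega : R -> R -> set (R * R)) (u : R -> R -> R * R -> R)
    (hOmega : standing_assumptions eps0 rho Omega)
    (hu : forall a e : R, 0 < a < 1 -> 0 < e < eps0 a ->
            torsion_solution (Omega a e) (u a e)) :
  exists bstar : R, 0 < bstar < 1 /\
    forall a : R, 0 < a < bstar ->
      exists delta : R, 0 < delta <= eps0 a /\
        forall e : R, 0 < e < delta ->
          exists p q : R * R, p <> q /\
            global_maximizer (Omega a e) (u a e) p /\
            global_maximizer (Omega a e) (u a e) q.
Proof.
(* 2 a < 1/288 = (1/6)^2 / 8, the value of the paraboloid at its centre. *)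
exists (576^-1); split; first by apply/andP; split; lra.
move=> a /andP[a0 ab]; have a1 : 0 < a < 1 by apply/andP; split; lra.
have [_ fam _ [mono union]] := hOmega a a1.
have : slit_disk a (2^-1, 2^-1).
  split; first by rewrite /unit_disk /=; lra.
  by case=> _ /=; lra.
rewrite -union => -[delta]; rewrite /= in_itv /= => /andP[d0 de0] Omd.
exists delta; split; first by rewrite d0 ltW.
move=> e /andP[e0 ed].
have ee : 0 < e < eps0 a by rewrite e0 (lt_trans ed).
have Omh : Omega a e (2^-1, 2^-1) by apply: (mono e delta).
have tu := hu a e a1 ee.
have [[_ OmE _] [[[oOm _ _] bOm] _ _ _ sym] P2 P5 _] := fam e ee.
move: (Omega a e) (u a e) Omh tu OmE oOm bOm sym P2 P5 => Om v.
move=> Omh tv OmE oOm bOm sym P2 P5.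
have sub1 : Om `<=` unit_disk by move=> q /P2[].
have disk q := @disk_sub_profile_domain _ _ _ q OmE P5 Omh.
have Omc : Om (0, 3^-1) by apply: disk => /=; lra.
have big := torsion_ge_paraboloid oOm bOm tv disk Omc.
have gap x : Om (x, 0) -> v (x, 0) < v (0, 3^-1).
  move=> Omx; have := torsion_le_barrier a0 oOm P2 tv Omx.
  have xa : `|x| <= a.
    have [x1 nslit] := P2 _ Omx; rewrite leNgt; apply/negP => ax.
    apply: nslit; split => //=; rewrite !in_itv /=.
    have {}x1 : `|x| < 1.
      rewrite -(@ltr_pXn2r _ 2) ?nnegrE// real_normK ?num_real// expr1n.
      by move: x1; rewrite /unit_disk /= expr0n /= addr0.
    by move: ax x1; case: (ger0P x) => _ ax x1; [right|left]; lra.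
  by have := slit_barrier_gap a0 xa; rewrite /= expr0n /=; lra.
have [_ cv _ bv] := tv.
have cl0 : closure Om !=set0 by exists (0, 3^-1); exact: subset_closure.
have [[x y]] := compact_EVT_max cl0 (bounded_closure_compact bOm) cv.
rewrite inE => clc cmax.
have {}cmax q : Om q -> v q <= v (x, y).
  by move=> Omq; apply: cmax; rewrite inE; exact: subset_closure.
have Omxy : Om (x, y).
  apply: contrapT => nOm; have := cmax _ Omc.
  rewrite (bv (x, y)); last by split => //; rewrite (interior_id _).1.
  by lra.
have y0 : y != 0.
  apply/eqP => y0; move: Omxy (cmax _ Omc); rewrite y0 => /gap; lra.
exists (x, y), (x, - y); split; first by case=> yN; move/eqP: y0; apply; lra.
split; first by split.
split; first exact: (sym x y).2.1.
move=> q Omq; rewrite (_ : v (x, - y) = v (x, y)); first exact: cmax.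
apply: (torsion_flip oOm sub1 _ tv Omxy).
by case=> x' y'; exact: (sym x' y').2.
Qed.
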